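(* Let $Z_i=(X_i,Y_i)$, $i=1,\dots,n+1$, be i.i.d. from a distribution $\mathcal P_{XY}=\mathcal P_X\times\mathcal P_{Y|X}$ on $\mathbb R^p\times\mathbb R$, let $V(\cdot)$ be a fixed real-valued score function with $V_i=V(Z_i)$, and use the localizer $H(x_1,x_2)=\exp(-d(x_1,x_2)/h_n)$ with bandwidth $h_n>0$ and dissimilarity $d(x_1,x_2)\in[0,\infty]$, $d(x,x)=0$ (with $\exp(-\infty)=0$). Let $p^H_{n+1,j}=H(X_{n+1},X_j)/\sum_{k=1}^{n+1}H(X_{n+1},X_k)$ and $\hat{\mathcal F}=\sum_{j=1}^np^H_{n+1,j}\delta_{V_j}+p^H_{n+1,n+1}\delta_{+\infty}$. Fix $x_0$ and fix $\alpha\in(0,1)$. Let $\tilde{\mathcal P}^{x_0}_X$ be the distribution with $\frac{d\tilde{\mathcal P}^{x_0}_X(x)}{dx}\propto\frac{d\mathcal P_X(x)}{dx}H(x_0,x)$. Conditional on $X_{n+1}=x_0$, let $\tilde Z=(\tilde X,\tilde Y)\sim\tilde{\mathcal P}^{x_0}_X\times\mathcal P_{Y|X}$, independent of $Z_1,\dots,Z_n$. Define $$\varepsilon(X_{n+1})=\max_{x:\,d(X_{n+1},x)<\infty}\ \max_y|V(X_{n+1},y)-V(x,y)|,\qquad \tilde C(X_{n+1})=\{y: V(X_{n+1},y)\le Q(\alpha;\hat{\mathcal F})+\varepsilon(X_{n+1})\}.$$ Then $$\mathbb P\{V(\tilde Z)\le Q(\alpha;\hat{\mathcal F})\mid X_{n+1}=x_0\}\ge\alpha,\qquad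 \mathbb P\{\tilde Y\in\tilde C(X_{n+1})\mid X_{n+1}=x_0\}\ge\alpha.$$
   Context: For a distribution $\mathcal F$ on $\mathbb R\cup\{+\infty\}$, $Q(\alpha;\mathcal F)=\inf\{t:\mathbb P_{T\sim\mathcal F}(T\le t)\ge\alpha\}$; $\delta_v$ is the point mass at $v$. *)

(* Defs.v *)
From mathcomp Require Import all_boot all_order all_algebra.
From mathcomp Require Import all_classical all_reals all_analysis.
From mathcomp Require Import measurable_realfun.
Set Implicit Arguments. Unset Strict Implicit. Unset Printing Implicit Defensive.
Import Order.TTheory GRing.Theory Num.Theory.
Local Open Scope classical_set_scope.
Local Open Scope ring_scope.

Section Defs.
Variable R : realType.

(* Localizer H(x1,x2) = exp(-d(x1,x2)/h), with exp(-oo) = 0.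
   (d is assumed nonnegative in the theorem, so the -oo branch is irrelevant.) *)
Definition loc_kernel (T : Type) (d : T -> T -> \bar R) (h : R) (x1 x2 : T) : R :=
  match d x1 x2 with
  | EFin r => expR (- (r / h))
  | _ => 0
  end.

(* Q(alpha; F) = inf { t : F(t) >= alpha }, F the cdf t |-> P(T <= t) of a
   distribution on R u {+oo}, t ranging over the extended reals. *)
Definition quantile (alpha : R) (F : \bar R -> R) : \bar R :=
  ereal_inf [set t : \bar R | alpha <= F t].

Definition wcdf (n : nat) (w : 'I_n -> R) (wl : R) (v : 'I_n -> R) (t : \bar R) : R :=
  \sum_(j < n) w j * ((v j)%:E <= t)%E%:R + wl * (+oo <= t)%E%:R.

(* Q(alpha; Fhat) where X_{n+1} = x0 and zs are Z_1..Z_n *)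
Definition Qhat (dX : measure_display) (X : measurableType dX) (n : nat)
  (d : X -> X -> \bar R) (h : R) (V : X * R -> R) (alpha : R) (x0 : X)
  (zs : 'I_n -> X * R) : \bar R :=
  let Hs := fun j : 'I_n => loc_kernel d h x0 (zs j).1 in
  let S := \sum_(k < n) Hs k + loc_kernel d h x0 x0 in
  quantile alpha
    (wcdf (fun j => Hs j / S) (loc_kernel d h x0 x0 / S) (fun j => V (zs j))).

Definition eps_shift (X : Type) (d : X -> X -> \bar R) (V : X * R -> R) (x0 : X)
  : \bar R :=
  ereal_sup [set e : \bar R | exists x y, (d x0 x < +oo)%E /\
                                 e = `|V (x0, y) - V (x, y)|%:E].

Definition mutually_indep (dO : measure_display) (O : measurableType dO)
  (dT : measure_display) (T : measurableType dT) (P : probability O R)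
  (n : nat) (Z : 'I_n -> O -> T) (Zt : O -> T) : Prop :=
  forall (A : 'I_n -> set T) (B : set T),
    (forall i, measurable (A i)) -> measurable B ->
    P [set w | (forall i, A i (Z i w)) /\ B (Zt w)] =
    ((\prod_(i < n) P (Z i @^-1` A i)) * P (Zt @^-1` B))%E.

End Defs.

(* Main.v *)
(** Write [H z] for the localizer weight at [x0].  The density of
    [(Zt, Z_1, ..., Z_n)] with respect to [PXY^(n+1)] is proportional to [H] of
    the first coordinate, so exchangeability of [PXY^(n+1)] turns the
    probability that the first coordinate is bad (the points with smaller score
    carry at least a fraction [alpha] of the total weight) into the average over
    all coordinates of their weight when bad.  For a fixed sample the bad points
    lie above the lowest bad one, hence carry at most a fraction [1 - alpha] of
    the weight.  The mass that the estimated distribution puts at [+oo] uses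
    [H(x0, x0) = 1] instead of [H Zt <= 1], which only raises the quantile.  For
    the second claim, [d(x0, Zt.1) < +oo] almost surely, since [H] is the
    density of [Zt]; there [V(x0, y)] exceeds [V(Zt)] by at most the shift. *)

Require Import Defs.
From HB Require Import structures.
From mathcomp Require Import all_boot all_order all_algebra.
From mathcomp Require Import fingroup perm.
From mathcomp Require Import all_classical all_reals all_analysis.
From mathcomp Require Import measurable_realfun lra.
Set Implicit Arguments. Unset Strict Implicit. Unset Printing Implicit Defensive.
Import Order.TTheory GRing.Theory Num.Theory.
Local Open Scope classical_set_scope.
Local Open Scope ring_scope.

(** * Finite weighted samples and their quantiles *)

Lemma weight_above_le (R : realFieldType) (m : nat) (W v : 'I_m -> R)
    (alpha : R) :
  (forall i, 0 <= W i) -> alpha <= 1 ->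
  \sum_i W i * (alpha * \sum_j W j <= \sum_j W j * (v j < v i)%R%:R)%R%:R
  <= (1 - alpha) * \sum_i W i.
Proof.
move=> W0 alpha1.
pose g i := alpha * \sum_j W j <= \sum_j W j * (v j < v i)%R%:R.
have [[i0 gi0]|ng] := pselect (exists i, g i); last first.
  rewrite big1 ?mulr_ge0 ?subr_ge0 ?sumr_ge0// => i _.
  rewrite -/(g i); have [gi|_] := boolP (g i); last by rewrite mulr0.
  by case: ng; exists i.
case: (@arg_minP _ _ _ i0 g v gi0) => i gi imin.
(* With [i] the bad index of least score, no bad index scores strictly below [v i]. The two groups
   are disjoint, and the second already carries a fraction [alpha] of the total. *)
have : \sum_k W k * (g k)%:R + \sum_j W j * (v j < v i)%R%:R <= \sum_k W k.
  rewrite -big_split/=; apply: ler_sum => k _; rewrite -mulrDr ler_piMr//.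
  have [gk|] := boolP (g k); last by rewrite add0r lern1 leq_b1.
  by rewrite ltNge imin// addr0.
move: gi; rewrite /g; lra.
Qed.

(** At points [t < u] the cdf never exceeds the mass strictly below [u], and it attains that mass at
    some such [t] because there are finitely many atoms. The atom at [+oo] is out of reach. *)
Lemma le_quantile_wcdf (R : realType) (n : nat) (W v : 'I_n -> R)
    (w alpha u : R) :
  (forall i, 0 <= W i) -> 0 < w -> 0 < alpha ->
  let S := \sum_j W j + w in
  (u%:E <= quantile alpha (wcdf (fun j => W j / S)%R (w / S)%R v))%E =
  (\sum_j W j * (v j < u)%R%:R < alpha * S).
Proof.
move=> W0 w0 a0 S.
have S0 : 0 < S by rewrite ltr_wpDl// sumr_ge0.
have sumE (b : 'I_n -> bool) :
    \sum_j W j / S * (b j)%:R = (\sum_j W j * (b j)%:R) / S.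
  by rewrite mulr_suml; apply: eq_bigr => j _; rewrite mulrAC.
apply/idP/idP => [|h].
- apply: contraTT; rewrite -leNgt -ltNge => h.
  (* A point below [u] that no atom below [u] exceeds; the default [u - 1] covers the case without
     such atoms. *)
  pose t := \big[Order.max/u - 1]_(j | v j < u) v j.
  have tu : t < u by apply: bigmax_lt => //; rewrite ltrBlDr ltrDl.
  apply: (@le_lt_trans _ _ t%:E); last by rewrite lte_fin.
  apply: ereal_inf_lbound => /=; rewrite /wcdf.
  rewrite (_ : (+oo <= t%:E)%E = false)// mulr0 addr0 sumE ler_pdivlMr//.
  apply: (le_trans h); apply: ler_sum => j _; rewrite ler_wpM2l// ler_nat.
  case: (boolP (v j < u)) => // vju; rewrite lt0b lee_fin.
  exact: le_bigmax_cond.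
- apply/ereal_infP => t /= Ft; rewrite leNgt; apply/negP => tu.
  move: Ft; apply/negP; rewrite -ltNge /wcdf.
  have -> : (+oo <= t)%E = false.
    by apply/negbTE; rewrite -ltNge (lt_trans tu)// ltry.
  rewrite mulr0 addr0 sumE ltr_pdivrMr//; apply: le_lt_trans h.
  apply: ler_sum => j _; rewrite ler_wpM2l// ler_nat.
  have [vt|//] := boolP ((v j)%:E <= t)%E.
  by rewrite -lte_fin (le_lt_trans vt).
Qed.

(** * Laws of random tuples, determined by their values on boxes *)

Section law_on_tuples.
Context {R : realType} {d : measure_display} {T : measurableType d} {n : nat}.

Definition box (A : 'I_n -> set T) : set (n.-tuple T) :=
  [set t | forall i, A i (tnth t i)].

Definition boxes : set_system (n.-tuple T) :=
  [set B | exists2 A : 'I_n -> set T, (forall i, measurable (A i)) & B = box A].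

Lemma boxE (A : 'I_n -> set T) :
  box A = \big[setI/setT]_i ((@tnth n T)^~ i @^-1` A i).
Proof.
apply/seteqP; split => t /=.
  move=> At; rewrite -bigcap_seq => i _; exact: At.
by rewrite -bigcap_seq => h i; apply: h; rewrite /= mem_index_enum.
Qed.

Lemma measurable_box (A : 'I_n -> set T) :
  (forall i, measurable (A i)) -> measurable (box A).
Proof.
move=> mA; rewrite boxE; apply: bigsetI_measurable => i _.
by rewrite -[X in measurable X]setTI; exact: measurable_tnth.
Qed.

Lemma measurable_tupleE : @measurable _ (n.-tuple T) = <<s boxes >>.
Proof.
apply/seteqP; split.
- apply: smallest_sub; first exact: smallest_sigma_algebra.
  rewrite -bigcup_seq => B [/= i _] [A mA <-]; apply: sub_sigma_algebra.
  (* A cylinder over coordinate [i] is a box whose other sides are full. *)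
  exists (fun j => if j == i then A else setT).
    by move=> j; case: ifPn.
  rewrite setTI; apply/seteqP; split => t /=.
    by move=> At j; case: ifPn => // /eqP ->.
  by move=> /(_ i); rewrite eqxx.
- apply: smallest_sub; first exact: sigma_algebra_measurable.
  by move=> _ [A mA ->]; exact: measurable_box.
Qed.

Lemma boxesI : setI_closed boxes.
Proof.
move=> _ _ [A mA ->] [B mB ->]; exists (fun i => A i `&` B i).
  by move=> i; exact: measurableI.
apply/seteqP; split => t /=; first by case=> At Bt i; split.
by move=> AB; split => i; case: (AB i).
Qed.

Context {d1 d2 : measure_display} {O1 : measurableType d1}
  {O2 : measurableType d2}.
Variables (mu1 : {measure set O1 -> \bar R}) (mu2 : {measure set O2 -> \bar R}).
Variables (f1 : O1 -> n.-tuple T) (f2 : O2 -> n.-tuple T).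
Hypotheses (mf1 : measurable_fun setT f1) (mf2 : measurable_fun setT f2).
Hypothesis mu1_fin : (mu1 setT < +oo)%E.
Hypothesis eq_box : forall A, (forall i, measurable (A i)) ->
  mu1 (f1 @^-1` box A) = mu2 (f2 @^-1` box A).

Let F1 : {mfun O1 >-> n.-tuple T} :=
  HB.pack f1 (isMeasurableFun.Build _ _ _ _ _ mf1).
Let F2 : {mfun O2 >-> n.-tuple T} :=
  HB.pack f2 (isMeasurableFun.Build _ _ _ _ _ mf2).

(** Boxes are a pi-system generating the sigma-algebra, and the whole space is itself a box of
    finite mass, so uniqueness of measures applies. *)
Lemma eq_law_tuple (B : set (n.-tuple T)) : measurable B ->
  mu1 (f1 @^-1` B) = mu2 (f2 @^-1` B).
Proof.
apply: (measure_unique boxes (fun=> setT) _ _ _ _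
  (pushforward mu1 F1) (pushforward mu2 F2)) => //.
- exact: measurable_tupleE.
- exact: boxesI.
- by move=> _; exists (fun=> setT) => //; apply/seteqP; split.
- by apply/seteqP; split => // t _; exists 0%N.
- by move=> _ [A mA ->]; exact: eq_box.
Qed.

Lemma eq_integral_law_tuple (g : n.-tuple T -> \bar R) :
  measurable_fun setT g -> (forall t, 0 <= g t)%E ->
  (\int[mu1]_x g (f1 x) = \int[mu2]_x g (f2 x))%E.
Proof.
move=> mg g0.
transitivity (\int[pushforward mu1 F1]_t g t)%E.
  by rewrite (ge0_integral_pushforward mf1).
transitivity (\int[pushforward mu2 F2]_t g t)%E; last first.
  by rewrite (ge0_integral_pushforward mf2).
by apply: eq_measure_integral => B mB _; exact: eq_law_tuple.
Qed.

End law_on_tuples.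

(** * Measurability of weighted counts *)

Lemma measurable_natb (R : realType) (d : measure_display)
    (U : measurableType d) (b : U -> bool) :
  measurable_fun setT b -> measurable_fun setT (fun x => (b x)%:R : R).
Proof.
move=> mb; rewrite (_ : (fun x => _) = (fun x => if b x then 1 else 0)).
  exact: measurable_fun_ifT.
by apply/funext => x; case: (b x).
Qed.

Lemma measurable_sum_lt (R : realType) (d : measure_display)
    (U : measurableType d) (m : nat) (a b : 'I_m -> U -> R) (u : U -> R) :
  (forall i, measurable_fun setT (a i)) ->
  (forall i, measurable_fun setT (b i)) -> measurable_fun setT u ->
  measurable_fun setT (fun x => \sum_i a i x * (b i x < u x)%R%:R).
Proof.
move=> ma mb mu; apply: measurable_sum => i; apply: measurable_funM => //.
exact: measurable_natb (measurable_fun_ltr (mb i) mu).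
Qed.

(** * Exchangeability with one reweighted coordinate *)

Section weighted_exchangeability.
Context {R : realType} {dT dO : measure_display} {T : measurableType dT}
  {O : measurableType dO} {n : nat}.
Variables (Q : probability T R) (P : probability O R).
Variables (Z : 'I_n -> O -> T) (Zt : O -> T) (W s : T -> R).
Hypotheses (mZ : forall i, measurable_fun setT (Z i))
  (mZt : measurable_fun setT Zt).
Hypotheses (mW : measurable_fun setT W) (ms : measurable_fun setT s).
Hypothesis W_ge0 : forall z, 0 <= W z.
Hypothesis indep : mutually_indep P Z Zt.
Hypothesis lawZ : forall i A, measurable A -> P (Z i @^-1` A) = Q A.

Let Zs (w : O) : n.-tuple T := [tuple Z i w | i < n].
(** A fresh draw from [Q] takes the place of [Zt]: under [P \x Q] all [n.+1] entries are i.i.d., and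
    the reweighting by [W] is carried by the integrand. *)
Let joint (p : O * T) : n.+1.-tuple T := [tuple of p.2 :: Zs p.1].

Let mZs : measurable_fun setT Zs.
Proof.
apply/measurable_fun_tnthP => i.
rewrite (_ : _ \o _ = Z i); first exact: mZ.
by apply/funext => w /=; rewrite tnth_mktuple.
Qed.

Let mjoint : measurable_fun setT joint.
Proof. by apply: measurable_cons => //; exact: measurableT_comp. Qed.

Let box_cons (A : 'I_n.+1 -> set T) z w :
  box A [tuple of z :: Zs w] <->
  A ord0 z /\ forall i, A (lift ord0 i) (Z i w).
Proof.
split=> [Azw|[A0 A1] i].
  split=> [|i]; first by have := Azw ord0; rewrite tnth0.
  by have := Azw (lift ord0 i); rewrite tnthS tnth_mktuple.
by have [j ->|->] := unliftP ord0 i; rewrite ?tnth0// tnthS tnth_mktuple.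
Qed.

Let indepZ (A : 'I_n -> set T) : (forall i, measurable (A i)) ->
  P [set w | forall i, A i (Z i w)] = (\prod_(i < n) P (Z i @^-1` A i))%E.
Proof.
move=> mA; have := indep mA measurableT.
rewrite preimage_setT probability_setT mule1 => <-; congr (P _).
by apply/seteqP; split => w //= [].
Qed.

Let measurable_Zbox (A : 'I_n -> set T) : (forall i, measurable (A i)) ->
  measurable [set w | forall i, A i (Z i w)].
Proof.
move=> mA; rewrite (_ : mkset _ = Zs @^-1` box A).
  by rewrite -[X in measurable X]setTI; apply: mZs => //; exact: measurable_box.
by apply/seteqP; split => w /= Aw i; move: (Aw i); rewrite tnth_mktuple.
Qed.

Let joint_box (A : 'I_n.+1 -> set T) : (forall i, measurable (A i)) ->
  (P \x Q)%E (joint @^-1` box A) = (\prod_i Q (A i))%E.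
Proof.
move=> mA.
rewrite (_ : _ @^-1` _ =
  [set w | forall i, A (lift ord0 i) (Z i w)] `*` A ord0); last first.
  by apply/seteqP; split => -[w z] /=; rewrite /joint/= box_cons => -[].
rewrite product_measure1E//; last first.
  exact: (@measurable_Zbox (fun i => A (lift ord0 i))).
rewrite [X in (X * _)%E](@indepZ (fun i => A (lift ord0 i)))//.
rewrite big_ord_recl muleC; congr (_ * _)%E.
by apply: eq_bigr => i _; rewrite lawZ.
Qed.

Let PQ_fin : ((P \x Q)%E setT < +oo)%E.
Proof.
rewrite -setXTT product_measure1E//.
rewrite [X in (X * _)%E](probability_setT P).
by rewrite [X in (_ * X)%E](probability_setT Q) mule1 ltry.
Qed.

(** Permuting the entries permutes the sides of a box, which leaves the product of their [Q]-masses
    unchanged. *)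
Lemma integral_joint_perm (p : {perm 'I_n.+1}) (g : n.+1.-tuple T -> \bar R) :
  measurable_fun setT g -> (forall t, 0 <= g t)%E ->
  (\int[P \x Q]_x g [tuple tnth (joint x) (p i) | i < n.+1] =
   \int[P \x Q]_x g (joint x))%E.
Proof.
move=> mg g0.
apply: (@eq_integral_law_tuple _ _ _ _ _ _ _ _ (P \x Q)%E (P \x Q)%E
  (fun x => [tuple tnth (joint x) (p i) | i < n.+1]) joint) => //.
  apply/measurable_fun_tnthP => i.
  rewrite (_ : _ \o _ = (@tnth _ T)^~ (p i) \o joint).
    by apply: measurableT_comp mjoint; exact: measurable_tnth.
  by apply/funext => x /=; rewrite tnth_mktuple.
move=> A mA; rewrite [RHS]joint_box//.
rewrite (_ : _ @^-1` _ = joint @^-1` box (fun i => A ((p^-1)%g i))).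
  by rewrite [LHS]joint_box// [RHS](reindex_inj (@perm_inj _ (p^-1)%g)).
apply/seteqP; split => x /= h i.
  by have := h ((p^-1)%g i); rewrite tnth_mktuple permKV.
by have := h (p i); rewrite tnth_mktuple permK.
Qed.

Variable alpha : R.

(** The event that entry [i] is bad, with the total weight multiplied out because it may vanish. In
    that case every entry is bad, harmlessly, since each weight in [f] is then zero. *)
Definition above_quantile m (i : 'I_m) (t : m.-tuple T) : bool :=
  alpha * \sum_j W (tnth t j) <=
  \sum_j W (tnth t j) * (s (tnth t j) < s (tnth t i))%R%:R.

Let mWtnth m (i : 'I_m) :
  measurable_fun [set: m.-tuple T] (fun t => W (tnth t i)).
Proof. by apply: measurableT_comp mW _; exact: measurable_tnth. Qed.

Let mstnth m (i : 'I_m) :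
  measurable_fun [set: m.-tuple T] (fun t => s (tnth t i)).
Proof. by apply: measurableT_comp ms _; exact: measurable_tnth. Qed.

Let mabove_quantile m (i : 'I_m) : measurable_fun setT (@above_quantile m i).
Proof.
apply: measurable_fun_ler.
  apply: measurable_funM => //; apply: measurable_sum => j; exact: mWtnth.
by apply: measurable_sum_lt => *; [exact: mWtnth|exact: mstnth..].
Qed.

Let f (i : 'I_n.+1) (t : n.+1.-tuple T) : \bar R :=
  (W (tnth t i) * (above_quantile i t)%:R)%:E.

Let f_ge0 i t : (0 <= f i t)%E.
Proof. by rewrite lee_fin mulr_ge0. Qed.

Let mf i : measurable_fun setT (f i).
Proof.
apply/measurable_EFinP; apply: measurable_funM; first exact: mWtnth.
by apply: measurable_natb; exact: mabove_quantile.
Qed.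

(** Swapping entries [0] and [i] preserves the joint law, and the sums over all entries in
    [above_quantile] do not see the swap. *)
Let integral_f i :
  (\int[P \x Q]_x f i (joint x) = \int[P \x Q]_x f ord0 (joint x))%E.
Proof.
rewrite -[RHS](integral_joint_perm (tperm ord0 i))//.
apply: eq_integral => x _; rewrite /f /above_quantile tnth_mktuple tpermL.
have reidx (F : T -> R) : \sum_j F (tnth (joint x) j) =
    \sum_j F (tnth [tuple tnth (joint x) (tperm ord0 i k) | k < n.+1] j).
  rewrite (reindex_inj (@perm_inj _ (tperm ord0 i))).
  by apply: eq_bigr => j _; rewrite tnth_mktuple.
rewrite (reidx W).
by rewrite (reidx (fun z => W z * (s z < s (tnth (joint x) i))%R%:R)).
Qed.

(** Exchangeability moves the weight to the fresh draw, where Fubini isolates it. *)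
Let integral_W i :
  (\int[P \x Q]_x (W (tnth (joint x) i))%:E = \int[Q]_z (W z)%:E)%E.
Proof.
transitivity (\int[P \x Q]_x (W (tnth (joint x) ord0))%:E)%E.
  rewrite -[RHS](integral_joint_perm (tperm ord0 i)
    (g := fun t => (W (tnth t ord0))%:E)).
  - by apply: eq_integral => x _; rewrite tnth_mktuple tpermL.
  - by apply/measurable_EFinP; exact: mWtnth.
  - by move=> t; rewrite lee_fin.
rewrite (fubini_tonelli1 (fun x => (W (tnth (joint x) ord0))%:E)).
- rewrite (eq_integral (cst (\int[Q]_z (W z)%:E)%E)).
    by rewrite integral_cst// [X in (_ * X)%E](probability_setT P) mule1.
  by [].
- by apply/measurable_EFinP; exact: (measurableT_comp (mWtnth ord0) mjoint).
- by move=> x; rewrite lee_fin.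
Qed.

Let integral_f0_le : alpha <= 1 ->
  (\int[P \x Q]_x f ord0 (joint x) <= (1 - alpha)%:E * \int[Q]_z (W z)%:E)%E.
Proof.
move=> alpha1.
have n1 : (0 < n.+1%:R%:E :> \bar R)%E by rewrite lte_fin.
(* After scaling by [n.+1], both sides become integrals of sums over all entries, which
   [weight_above_le] compares pointwise. *)
rewrite -(@lee_pmul2l _ n.+1%:R%:E)//.
have -> : (n.+1%:R%:E * \int[P \x Q]_x f ord0 (joint x) =
    \int[P \x Q]_x \sum_i f i (joint x))%E.
  rewrite ge0_integral_sum//; last first.
    by move=> i; exact: (measurableT_comp (mf i) mjoint).
  rewrite (eq_bigr (fun=> \int[P \x Q]_x f ord0 (joint x))%E)//.
  by rewrite sumr_const card_ord mule_natl.
have -> : (n.+1%:R%:E * ((1 - alpha)%:E * \int[Q]_z (W z)%:E) =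
    \int[P \x Q]_x ((1 - alpha)%:E * \sum_i (W (tnth (joint x) i))%:E))%E.
  have mWj i : measurable_fun setT (fun x => (W (tnth (joint x) i))%:E).
    by apply/measurable_EFinP; exact: (measurableT_comp (mWtnth i) mjoint).
  rewrite ge0_integralZl//; last 3 first.
  - by apply: emeasurable_sum.
  - by move=> x _; apply: sume_ge0 => i _; rewrite lee_fin.
  - by rewrite lee_fin subr_ge0.
  rewrite muleCA ge0_integral_sum//; last by move=> i x _; rewrite lee_fin.
  congr (_ * _)%E; rewrite (eq_bigr (fun=> \int[Q]_z (W z)%:E)%E).
    by rewrite sumr_const card_ord mule_natl.
  by move=> i _; rewrite integral_W.
apply: ge0_le_integral => //.
- by move=> x _; exact: sume_ge0.
- apply: emeasurable_sum => i; exact: (measurableT_comp (mf i) mjoint).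
- apply: emeasurable_funM => //; apply: emeasurable_sum => i.
  by apply/measurable_EFinP; exact: (measurableT_comp (mWtnth i) mjoint).
move=> x _; rewrite !sumEFin -EFinM lee_fin.
exact: (@weight_above_le _ _ (fun i => W (tnth (joint x) i))
  (fun i => s (tnth (joint x) i))).
Qed.

Hypothesis lawZt : forall A, measurable A ->
  (P (Zt @^-1` A) * \int[Q]_z (W z)%:E = \int[Q]_(z in A) (W z)%:E)%E.

Let real : O -> n.+1.-tuple T := fun w => [tuple of Zt w :: Zs w].

Let mreal : measurable_fun setT real.
Proof. by apply: measurable_cons. Qed.

(* By independence [Zt] may be drawn on a separate copy of the sample space;
   then [lawZt] applies section by section. *)
Let prob_above_quantile :
  (P [set w | above_quantile ord0 (real w)] * \int[Q]_z (W z)%:E =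
   \int[P \x Q]_x f ord0 (joint x))%E.
Proof.
pose cpl (x : O * O) : n.+1.-tuple T := [tuple of Zt x.2 :: Zs x.1].
have mcpl : measurable_fun setT cpl.
  by apply: measurable_cons; exact: measurableT_comp.
have mB : measurable [set t : n.+1.-tuple T | above_quantile ord0 t].
  rewrite -[X in measurable X]setTI; exact: mabove_quantile.
(* The laws of [real] and [cpl] agree on boxes: independence factors one probability, the product
   measure the other. *)
have -> : P [set w | above_quantile ord0 (real w)] =
    (P \x P)%E (cpl @^-1` [set t | above_quantile ord0 t]).
  apply: (@eq_law_tuple _ _ _ _ _ _ _ _ P (P \x P)%E real cpl) => //.
    by rewrite [X in (X < _)%E](probability_setT P) ltry.
  move=> A mA.
  rewrite (_ : cpl @^-1` _ = [set w | forall i, A (lift ord0 i) (Z i w)]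
    `*` (Zt @^-1` A ord0)); last first.
    by apply/seteqP; split => -[w w'] /=; rewrite /cpl/= box_cons => -[].
  rewrite [RHS]product_measure1E//; last 2 first.
  - exact: (@measurable_Zbox (fun i => A (lift ord0 i))).
  - by rewrite -[X in measurable X]setTI; exact: mZt.
  rewrite [X in (_ = X * _)%E](@indepZ (fun i => A (lift ord0 i)))//.
  rewrite -[RHS]indep//; congr (P _).
  by apply/seteqP; split => w /=; rewrite box_cons => -[].
rewrite [X in (X * _)%E]/product_measure1 -ge0_integralZr//; last 2 first.
- apply: (measurable_fun_xsection P).
  by rewrite -[X in measurable X]setTI; exact: mcpl.
- by apply: integral_ge0 => z _; rewrite lee_fin.
rewrite (fubini_tonelli1 (fun x => f ord0 (joint x)))//; last first.
  exact: (measurableT_comp (mf ord0) mjoint).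
apply: eq_integral => w _; rewrite /fubini_F /=.
have mBw : measurable [set z | above_quantile ord0 (joint (w, z))].
  rewrite -[X in measurable X]setTI.
  exact: (measurableT_comp mjoint (pair1_measurable w) measurableT mB).
rewrite (_ : xsection _ _ =
    Zt @^-1` [set z | above_quantile ord0 (joint (w, z))]).
  rewrite lawZt// integral_mkcond; apply: eq_integral => z _.
  rewrite patchE /f; have [h|h] := boolP (above_quantile ord0 (joint (w, z))).
    by rewrite mem_set// mulr1 tnth0.
  by rewrite memNset ?mulr0//=; exact/negP.
by apply/seteqP; split => w' /=; rewrite /xsection/= inE.
Qed.

Lemma weighted_exchangeability_bound :
  alpha <= 1 -> (0 < \int[Q]_z (W z)%:E < +oo)%E ->
  (P [set w | alpha * (\sum_i W (Z i w) + W (Zt w)) <=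
     \sum_i W (Z i w) * (s (Z i w) < s (Zt w))%R%:R]%R <= (1 - alpha)%:E)%E.
Proof.
move=> alpha1 /andP[c0 coo].
have cfin : (\int[Q]_z (W z)%:E)%E \is a fin_num.
  by rewrite ge0_fin_numE// ltW.
(* Multiplying by the positive finite normalising constant matches the undivided form of [lawZt]. *)
rewrite -(lee_pmul2r cfin)//.
rewrite (_ : mkset _ = [set w | above_quantile ord0 (real w)]).
  by rewrite prob_above_quantile; exact: integral_f0_le.
apply/funext => w /=; rewrite /above_quantile !big_ord_recl !tnth0.
(* [Zt] is not strictly below itself, so its own weight drops out of the right-hand sum but stays in
   the total. *)
rewrite ltxx mulr0 add0r addrC; congr (is_true (_ * (_ + _) <= _)).
  by apply: eq_bigr => i _; rewrite tnthS tnth_mktuple.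
by apply: eq_bigr => i _; rewrite tnthS tnth_mktuple.
Qed.

End weighted_exchangeability.

(** * Bounds and measurability of the localizer *)

Section localizer.
Context {R : realType} {X : Type}.
Variables (d : X -> X -> \bar R) (h : R).

Lemma loc_kernel_ge0 x1 x2 : 0 <= loc_kernel d h x1 x2.
Proof. by rewrite /loc_kernel; case: (d x1 x2) => // r; exact: expR_ge0. Qed.

Lemma loc_kernel_le1 x1 x2 : 0 < h -> (0 <= d x1 x2)%E ->
  loc_kernel d h x1 x2 <= 1.
Proof.
move=> h0; rewrite /loc_kernel; case: (d x1 x2) => // r r0.
by rewrite -expR0 ler_expR oppr_le0 divr_ge0// ltW.
Qed.

Lemma loc_kernel_refl x : d x x = 0%E -> loc_kernel d h x x = 1.
Proof. by rewrite /loc_kernel => -> /=; rewrite mul0r oppr0 expR0. Qed.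

Lemma loc_kernel_neq0_lty x1 x2 : (0 <= d x1 x2)%E ->
  loc_kernel d h x1 x2 != 0 -> (d x1 x2 < +oo)%E.
Proof.
by rewrite /loc_kernel; case: (d x1 x2) => //= [r|]; rewrite ?ltry ?eqxx.
Qed.

End localizer.

Lemma measurable_loc_kernel (R : realType) (dX : measure_display)
    (X : measurableType dX) (d : X -> X -> \bar R) (h : R) (x0 : X) :
  measurable_fun setT (d x0) -> measurable_fun setT (loc_kernel d h x0).
Proof.
move=> md; rewrite (_ : loc_kernel d h x0 = (fun x =>
  if d x0 x \is a fin_num then expR (- (fine (d x0 x) / h)) else 0)).
  apply: measurable_fun_ifT => //.
    by apply: (measurable_fun_bool true); exact: emeasurable_fin_num.
  apply: measurableT_comp; first exact: measurable_expR.
  apply: measurableT_comp => //; apply: measurable_funM => //.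
  exact: measurableT_comp.
by apply/funext => x; rewrite /loc_kernel; case: (d x0 x).
Qed.

(** * The localized quantile as a comparison of finite sums *)

Section local_quantile.
Context {R : realType} {dX : measure_display} {X : measurableType dX}.
Variables (d : X -> X -> \bar R) (h : R) (V : X * R -> R) (alpha : R) (x0 : X).
Hypotheses (d_refl : d x0 x0 = 0%E) (alpha_gt0 : 0 < alpha).

Let H (z : X * R) := loc_kernel d h x0 z.1.

(** The [1] is the weight of [x0] itself. This form yields measurability, and its negation resembles
    the event of the exchangeability bound. *)
Lemma le_Qhat n (zs : 'I_n -> X * R) (u : R) :
  (u%:E <= Qhat d h V alpha x0 zs)%E =
  (\sum_j H (zs j) * (V (zs j) < u)%R%:R < alpha * (\sum_j H (zs j) + 1)).
Proof.
rewrite /Qhat (loc_kernel_refl _ d_refl).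
by apply: le_quantile_wcdf => // j; exact: loc_kernel_ge0.
Qed.

(** Rules out [-oo + +oo] when the shift is infinite. No atom lies strictly below the least score,
    so no mass does. *)
Lemma Qhat_gtNy n (zs : 'I_n -> X * R) : (-oo < Qhat d h V alpha x0 zs)%E.
Proof.
pose u := \big[Order.min/0]_j V (zs j).
apply: (@lt_le_trans _ _ u%:E); first exact: ltNyr.
rewrite le_Qhat big1 => [|j _].
  by rewrite mulr_gt0// ltr_wpDl// sumr_ge0// => j _; exact: loc_kernel_ge0.
by rewrite ltNge bigmin_le_cond ?mulr0.
Qed.

Lemma measurable_le_Qhat dO (O : measurableType dO) n
    (Z : 'I_n -> O -> X * R) (u : O -> R) :
  measurable_fun setT (d x0) -> measurable_fun setT V ->
  (forall i, measurable_fun setT (Z i)) -> measurable_fun setT u ->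
  measurable [set w | ((u w)%:E <= Qhat d h V alpha x0 (fun j => Z j w))%E].
Proof.
move=> md mV mZ mu.
have mH i : measurable_fun setT (fun w => H (Z i w)).
  apply: (measurableT_comp (measurable_loc_kernel h md)).
  exact: measurableT_comp.
have mVZ i : measurable_fun setT (V \o Z i) by exact: measurableT_comp.
rewrite (_ : mkset _ = [set w | \sum_j H (Z j w) * (V (Z j w) < u w)%R%:R <
    alpha * (\sum_j H (Z j w) + 1)]); last first.
  by apply/funext => w; rewrite /= le_Qhat.
rewrite -[X in measurable X]setTI; apply: measurable_fun_ltr => //.
  exact: (measurable_sum_lt mH mVZ).
apply: measurable_funM => //; apply: measurable_funD => //.
exact: measurable_sum.
Qed.

End local_quantile.

(** * The two coverage bounds *)

Theorem theorem4 (R : realType)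
  (dX : measure_display) (X : measurableType dX)
  (PXY : probability (X * R)%type R)
  (V : X * R -> R) (mV : measurable_fun setT V)
  (d : X -> X -> \bar R)
  (d_ge0 : forall x1 x2, (0 <= d x1 x2)%E) (d_refl : forall x, d x x = 0%E)
  (h : R) (h_gt0 : 0 < h)
  (n : nat) (x0 : X) (md : measurable_fun [set: X] (d x0 : X -> \bar R))
  (alpha : R) (alpha_gt0 : 0 < alpha) (alpha_lt1 : alpha < 1)
  (norm_pos : (0 < \int[PXY]_z (loc_kernel d h x0 z.1)%:E)%E)
  (dO : measure_display) (O : measurableType dO) (P : probability O R)
  (Z : 'I_n -> O -> X * R) (Zt : O -> X * R)
  (mZ : forall i, measurable_fun setT (Z i)) (mZt : measurable_fun setT Zt)
  (lawZ : forall i (A : set (X * R)), measurable A -> P (Z i @^-1` A) = PXY A)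
  (lawZt : forall A : set (X * R), measurable A ->
     (P (Zt @^-1` A) * \int[PXY]_z (loc_kernel d h x0 z.1)%:E =
      \int[PXY]_(z in A) (loc_kernel d h x0 z.1)%:E)%E)
  (indep : mutually_indep P Z Zt) :
  (alpha%:E <= P [set w | ((V (Zt w))%:E <= Qhat d h V alpha x0 (fun j => Z j w))%E])%E
  /\
  (alpha%:E <= P [set w | ((V (x0, (Zt w).2))%:E <=
                           Qhat d h V alpha x0 (fun j => Z j w) + eps_shift d V x0)%E])%E.
Proof.
pose H (z : X * R) := loc_kernel d h x0 z.1.
have H0 z : 0 <= H z by exact: loc_kernel_ge0.
have H1 z : H z <= 1 by exact: loc_kernel_le1.
have mH : measurable_fun setT H.
  exact: (measurableT_comp (measurable_loc_kernel h md) measurable_fst).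
have c_fin : (\int[PXY]_z (H z)%:E < +oo)%E.
  apply: (@le_lt_trans _ _ (\int[PXY]_z 1)%E).
    apply: ge0_le_integral => // [z _||z _].
    - by rewrite lee_fin.
    - exact/measurable_EFinP.
    - by rewrite lee_fin.
  by rewrite integral_cst// mul1e [X in (X < _)%E](probability_setT PXY) ltry.
pose E1 := [set w | ((V (Zt w))%:E <=
  Qhat d h V alpha x0 (fun j => Z j w))%E].
have mE1 : measurable E1.
  by apply: measurable_le_Qhat => //; exact: measurableT_comp.
have PE1 : (alpha%:E <= P E1)%E.
  suff : (P (~` E1) <= (1 - alpha)%:E)%E.
    rewrite probability_setC// -[P E1]fineK ?fin_num_measure//.
    by rewrite -EFinB !lee_fin lerD2l lerN2.
  have mHZ i : measurable_fun setT (H \o Z i) by exact: measurableT_comp.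
  have mVZ i : measurable_fun setT (V \o Z i) by exact: measurableT_comp.
  apply: le_trans (weighted_exchangeability_bound mZ mZt mH mV H0 indep lawZ
    lawZt (ltW alpha_lt1) _); last by rewrite norm_pos.
  apply: le_measure; rewrite ?inE.
  - exact: measurableC.
  - rewrite -[X in measurable X]setTI; apply: measurable_fun_ler => //.
      apply: measurable_funM => //; apply: measurable_funD.
        exact: measurable_sum.
      exact: measurableT_comp.
    by apply: (measurable_sum_lt mHZ mVZ); exact: measurableT_comp.
  (* Failure of [E1] is the bad event with weight [1] in place of [H (Zt w)]; as [H <= 1], it
     implies the bad event. *)
  - move=> w /=; rewrite /E1/= le_Qhat// => /negP; rewrite -leNgt.
    by apply: le_trans; rewrite ler_pM2l// lerD2l.
split=> //.
pose e := eps_shift d V x0.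
pose E2 := [set w | ((V (x0, (Zt w).2))%:E <=
  Qhat d h V alpha x0 (fun j => Z j w) + e)%E].
have e0 : (0 <= e)%E.
  apply: ereal_sup_ubound; exists x0, 0.
  by rewrite d_refl ltry subrr normr0.
have mE2 : measurable E2.
  have mVx0 : measurable_fun setT (fun w => V (x0, (Zt w).2)).
    apply: measurableT_comp => //; apply: measurable_fun_pair => //.
    exact: measurableT_comp.
  (* An infinite shift makes [E2] the whole space; a finite one can be moved to the score side. *)
  have [eoo|efin] := eqVneq e +oo%E.
    rewrite (_ : E2 = setT)//; apply/seteqP; split => // w _.
    by rewrite /E2/= eoo addey ?leey// gt_eqF// Qhat_gtNy.
  have ereal : e \is a fin_num by rewrite ge0_fin_numE// ltey.
  rewrite (_ : E2 = [set w | ((V (x0, (Zt w).2) - fine e)%:E <=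
      Qhat d h V alpha x0 (fun j => Z j w))%E]).
    by apply: measurable_le_Qhat => //; exact: measurable_funB.
  by apply/funext => w; rewrite /E2/= EFinB fineK// leeBlDr.
have mN0 : measurable [set z | H z = 0].
  by rewrite -[X in measurable X]setTI;
    exact: (mH measurableT _ (measurable_set1 0)).
pose N := Zt @^-1` [set z | H z = 0].
have mN : measurable N.
  by rewrite -[X in measurable X]setTI; exact: mZt.
(* The integral of [H] over its zero set vanishes, while the normalising constant is positive. *)
have PN : P N = 0%E.
  have := lawZt _ mN0; rewrite -/N [X in _ = X]integral0_eq; last first.
    by move=> z /=; rewrite /H => ->.
  by move/eqP; rewrite mule_eq0 (gt_eqF norm_pos) orbF => /eqP.
apply: (le_trans PE1).
(* Adding the null event reduces the second bound to the inclusion of [E1] in the union of [E2] and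
   [N]. *)
rewrite -[leRHS]adde0 -PN.
apply: (le_trans _ (measureU2 P mE2 mN)).
apply: le_measure; rewrite ?inE//; first exact: measurableU.
move=> w E1w; have [HZt|HZt] := eqVneq (H (Zt w)) 0; [by right|left].
apply: (@le_trans _ _ ((V (Zt w))%:E + e)%E); last exact: leeD2r.
rewrite addeC -leeBlDr// -EFinB.
apply: (@le_trans _ _ `|V (x0, (Zt w).2) - V (Zt w)|%:E).
  by rewrite lee_fin ler_norm.
(* Off [N] the weight of [Zt w] is nonzero, so its distance from [x0] is finite and it competes in
   the supremum. *)
apply: ereal_sup_ubound; exists (Zt w).1, (Zt w).2; split.
  exact: loc_kernel_neq0_lty HZt.
by rewrite -surjective_pairing.
Qed.
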